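(* Let $P$ be a DATALOG program, and let $c$ be a constraint and $i$ an instruction satisfying hypotheses $H_1$ and $H_2$ below. Then the following formulas are weakest preconditions for $c$ and $i$: 1. $wp(\texttt{foreach }\overline x:\Phi(\overline x)\texttt{ do }insert_R(\overline x),c)=c[r\rightarrow r']$, where the program defining the IDBs is $P'_r\cup\{r'(\overline x)\leftarrow r(\overline x),\ r'(\overline x)\leftarrow\Phi(\overline x)\}$; 2. $wp(\texttt{foreach }\overline x:\Phi(\overline x)\texttt{ do }delete_R(\overline x),c)=c[r\rightarrow r']$, where the program defining the IDBs is $P'_r\cup\{r'(\overline x)\leftarrow r(\overline x)\wedge\neg t(\overline x),\ t(\overline x)\leftarrow\Phi(\overline x)\}$ with $t$ a new IDB predicate; 3. $wp((i_1;i_2),c)=wp(i_1,wp(i_2,c))$; 4. $wp(\texttt{if }cond\texttt{ then }inst1\texttt{ else }inst2,c)=(cond\wedge wp(inst1,c))\vee(\neg cond\wedge wp(inst2,c))$. Hypotheses: $H_1$: the qualifications $\Phi(\overline x)$ are conjunctions of literals, and all rules defining the IDBs occurring in the constraint $c$, the qualifications and the conditions $cond$ are in $P$. $H_2$: in statements $\texttt{foreach }\overline x:\Phi(\overline x)\texttt{ do }insert_R(\overline x)$ or $\texttt{foreach }\overline x:\Phi(\overline x)\texttt{ do }delete_R(\overline x)$, no literal of $\Phi(\overline x)$ depends on $r$.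
   Context: A database has extensional predicates (EDBs) $r_1,\dots,r_k$ naming finite relations; a DATALOG program is a finite set of function-free Horn rules $q(\overline y)\leftarrow q_1(\overline y_1),\dots,q_p(\overline y_p)$ with $q$ an intensional predicate (IDB) and the $q_i$ IDBs or EDBs; IDBs are interpreted by the program (least fixpoint; with a negated body atom the program is a stratified DATALOG$^\neg$ program). Constraints $c$ and conditions $cond$ are clauses (closed universal disjunctions of literals) whose atoms may be EDBs or IDBs defined by (possibly recursive) rules; qualifications $\Phi(\overline x)$ likewise may contain IDB atoms. Instructions: $\texttt{foreach }\overline x:\Phi(\overline x)\texttt{ do }insert_R(\overline x)$ adds to $R$ the tuples satisfying $\Phi$; the $delete$ version removes them; $(i_1;i_2)$ executes $i_1$ then $i_2$; $\texttt{if }cond\texttt{ then }inst1\texttt{ else }inst2$ executes $inst1$ if $cond$ holds in the current database, else $inst2$. $q$ depends directly on $r$ if $q=r$ or $r$ occurs in the body of a rule defining $q$; depends is the transitive closure. $P'_r$ is obtained from $P$ by adding, for each predicate $q$ depending on $r$, a new IDB symbol $q'$, and for each rule $\rho$ of $P$ defining an IDB $q$ depending on $r$, a new rule $\rho'$ obtained from $\rho$ by replacing every symbol $s$ depending on $r$ by $s'$; if $r$ is an EDB a new IDB $r'$ is added whose defining rules are those given in the statement. $c[r\rightarrow r']$ denotes $c$ with every predicate depending on $r$ (including $r$) replaced by its primed version. A formula $f$ is a precondition for update $u$ and constraint $c$ if $B\models f$ implies $u(B)\models c$ for every database $B$; it is a weakest precondition if it is implied by every precondition for $(u,c)$. *)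

(* Defs.v *)
From HB Require Import structures.
From Stdlib Require Import Relation_Operators.
From mathcomp Require Import all_boot.
From mathcomp Require Import boolp classical_sets functions cardinality.

Set Implicit Arguments.
Unset Strict Implicit.
Unset Printing Implicit Defensive.

Local Open Scope classical_set_scope.

(* The EDBs are r_1, ..., r_k; their arities are a parameter [ar : 'I_k -> nat].
   IDB names carry their arity, so there are infinitely many names of each. *)
Inductive symb (k : nat) := Edb of 'I_k | Idb of nat & nat.
Arguments Idb {k} name arity.

Definition symb_code k (s : symb k) : 'I_k + nat * nat :=
  match s with Edb r => inl r | Idb n a => inr (n, a) end.
Definition symb_decode k (s : 'I_k + nat * nat) : symb k :=
  match s with inl r => Edb r | inr (n, a) => Idb n a end.
Lemma symb_codeK k : cancel (@symb_code k) (@symb_decode k).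
Proof. by case. Qed.
HB.instance Definition _ k := Countable.copy (symb k) (can_type (@symb_codeK k)).

Definition is_idb k (s : symb k) := if s is Idb _ _ then true else false.
Definition arity k (ar : 'I_k -> nat) (s : symb k) :=
  match s with Edb r => ar r | Idb _ a => a end.

(* The constants are the elements of the domain D of values. *)
Inductive term (D : Type) := Var of nat | Cst of D.
Arguments Var {D} x.

Definition term_code D (t : term D) : nat + D :=
  match t with Var x => inl x | Cst d => inr d end.
Definition term_decode D (t : nat + D) : term D :=
  match t with inl x => Var x | inr d => Cst d end.
Lemma term_codeK D : cancel (@term_code D) (@term_decode D).
Proof. by case. Qed.
HB.instance Definition _ (D : eqType) :=
  Equality.copy (term D) (can_type (@term_codeK D)).

Notation atom D k := (symb k * seq (term D))%type.
(* [(true, A)] is the literal A and [(false, A)] the literal ~ A. *)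
Notation literal D k := (bool * atom D k)%type.
Notation rule D k := (atom D k * seq (literal D k))%type.
Notation program D k := (seq (rule D k)).
(* A clause is the universal closure of the disjunction of its literals. *)
Notation clause D k := (seq (literal D k)).

Inductive formula (D : Type) (k : nat) :=
| FFalse
| FAtom of atom D k
| FNot of formula D k
| FAnd of formula D k & formula D k
| FOr of formula D k & formula D k
| FAll of nat & formula D k.
Arguments FFalse {D k}.

(* [Insert r x Phi] is  foreach x : Phi(x) do insert_r(x) ; the list [Phi]
   stands for the conjunction of its literals. *)
Inductive instr (D : Type) (k : nat) :=
| Insert of 'I_k & seq nat & seq (literal D k)
| Delete of 'I_k & seq nat & seq (literal D k)
| Seq of instr D k & instr D k
| If of clause D k & instr D k & instr D k.

Section Syntax.
Variables (D : pointedType) (k : nat) (ar : 'I_k -> nat).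
Implicit Types (A : atom D k) (l : literal D k) (rho : rule D k).
Implicit Types (P Q : program D k) (c : clause D k) (f : formula D k).
Implicit Types (i : instr D k) (s q : symb k).

Definition lit_symb l := l.2.1.
Definition head_symb rho := rho.1.1.
Definition rule_symbs rho := head_symb rho :: map lit_symb rho.2.
Definition program_idbs P := filter (@is_idb k) (flatten (map rule_symbs P)).

Fixpoint instr_symbs i : seq (symb k) :=
  match i with
  | Insert _ _ Phi | Delete _ _ Phi => map lit_symb Phi
  | Seq i1 i2 => instr_symbs i1 ++ instr_symbs i2
  | If cond i1 i2 => map lit_symb cond ++ instr_symbs i1 ++ instr_symbs i2
  end.

Definition term_vars (t : term D) := if t is Var x then [:: x] else [::].
Definition atom_vars A := flatten (map term_vars A.2).

Fixpoint free_vars f : seq nat :=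
  match f with
  | FFalse => [::]
  | FAtom A => atom_vars A
  | FNot g => free_vars g
  | FAnd g h | FOr g h => free_vars g ++ free_vars h
  | FAll x g => filter (predC1 x) (free_vars g)
  end.
Definition closed f := free_vars f = [::].

Definition lit_fml l := if l.1 then FAtom l.2 else FNot (FAtom l.2).
Definition clause_fml c : formula D k :=
  foldr (@FAll D k) (foldr (@FOr D k) FFalse (map lit_fml c))
        (undup (flatten (map (fun l => atom_vars l.2) c))).

Definition wf_atom A := size A.2 == arity ar A.1.
Definition wf_lits (ls : seq (literal D k)) := all (fun l => wf_atom l.2) ls.
Definition wf_rule rho :=
  [&& is_idb (head_symb rho), wf_atom rho.1 & wf_lits rho.2].
Definition wf_program P := all wf_rule P.

Fixpoint wf_fml f : bool :=
  match f with
  | FFalse => true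
  | FAtom A => wf_atom A
  | FNot g | FAll _ g => wf_fml g
  | FAnd g h | FOr g h => wf_fml g && wf_fml h
  end.

Fixpoint wf_instr i : bool :=
  match i with
  | Insert r x Phi | Delete r x Phi =>
      [&& size x == ar r, uniq x & wf_lits Phi]
  | Seq i1 i2 => wf_instr i1 && wf_instr i2
  | If cond i1 i2 => [&& wf_lits cond, wf_instr i1 & wf_instr i2]
  end.

(* DATALOG programs are the Horn ones; [program] allows negated body atoms. *)
Definition horn P := all (fun rho => all (fun l => l.1) rho.2) P.
Definition datalog P := wf_program P && horn P.

Definition stratification (sigma : symb k -> nat) P :=
  forall rho l, rho \in P -> l \in rho.2 ->
    if l.1 then sigma (lit_symb l) <= sigma (head_symb rho)
    else sigma (lit_symb l) < sigma (head_symb rho).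
Definition stratified P := exists sigma, stratification sigma P.

Definition depends_directly P q s :=
  q = s \/
  exists rho, [/\ rho \in P, head_symb rho = q & s \in map lit_symb rho.2].
Definition depends P : symb k -> symb k -> Prop :=
  clos_trans _ (depends_directly P).

End Syntax.

Section Semantics.
Variables (D : pointedType) (k : nat) (ar : 'I_k -> nat).
Implicit Types (P Q : program D k) (c : clause D k) (f g : formula D k).
Implicit Types (i : instr D k) (v : nat -> D).

Notation interp := (symb k -> set (seq D)).
Notation instance := ('I_k -> set (seq D)).

Definition database (B : instance) :=
  forall r, finite_set (B r) /\ (forall a, B r a -> size a = ar r).

Definition eval v (t : term D) := match t with Var x => v x | Cst d => d end.
Definition holds (I : interp) v (A : atom D k) := I A.1 (map (eval v) A.2).

(* Least set of facts containing J and closed under the rules of R, where the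
   negated body atoms are evaluated in J. *)
Inductive lfp (R : program D k) (J : interp) : symb k -> seq D -> Prop :=
| lfp_base s a : J s a -> lfp R J s a
| lfp_rule (rho : rule D k) v : rho \in R ->
    (forall A, (true, A) \in rho.2 -> lfp R J A.1 (map (eval v) A.2)) ->
    (forall A, (false, A) \in rho.2 -> ~ holds J v A) ->
    lfp R J rho.1.1 (map (eval v) rho.1.2).

Definition edb_facts (B : instance) : interp :=
  fun s => if s is Edb r then B r else set0.

(* Iterated least fixpoint: stratum after stratum, starting from the EDBs. *)
Fixpoint strata (sigma : symb k -> nat) P (B : instance) (n : nat) : interp :=
  if n is m.+1 then
    lfp [seq rho <- P | sigma (head_symb rho) == m] (strata sigma P B m)
  else edb_facts B.

(* The iterated fixpoint does not depend on the stratification; for a Horn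
   program it is the least fixpoint. *)
Definition model P (B : instance) : interp :=
  fun s a => exists sigma, stratification sigma P /\
    exists n, strata sigma P B n s a.

Fixpoint sat (I : interp) v f : Prop :=
  match f with
  | FFalse => False
  | FAtom A => holds I v A
  | FNot g => ~ sat I v g
  | FAnd g h => sat I v g /\ sat I v h
  | FOr g h => sat I v g \/ sat I v h
  | FAll x g => forall d, sat I (fun y => if y == x then d else v y) g
  end.

(* B |= f, with the IDBs of f defined by P. *)
Definition models P (B : instance) f := forall v, sat (model P B) v f.

(* The tuples x satisfying Phi; variables of Phi outside x, if any, are read
   existentially, as in the rule bodies. *)
Definition answers P (B : instance) (x : seq nat) (Phi : seq (literal D k))
  : set (seq D) :=
  [set a | exists v, a = map v x /\
     forall l, l \in Phi -> sat (model P B) v (lit_fml l)].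

Fixpoint exec P i (B : instance) : instance :=
  match i with
  | Insert r x Phi =>
      fun s => if s == r then B s `|` answers P B x Phi else B s
  | Delete r x Phi =>
      fun s => if s == r then B s `\` answers P B x Phi else B s
  | Seq i1 i2 => exec P i2 (exec P i1 B)
  | If cond i1 i2 =>
      if `[< models P B (clause_fml cond) >] then exec P i1 B else exec P i2 B
  end.

(* A sentence f comes with the program Q defining its IDBs. *)
Definition sentence Q f :=
  [/\ wf_program ar Q, stratified Q, wf_fml ar f & closed f].

(* The IDBs of the update i and of the constraint f0 are defined by P. *)
Definition precondition P i f0 Q f :=
  sentence Q f /\
  forall B, database B -> models Q B f -> models P (exec P i B) f0.

Definition weakest_precondition P i f0 Q f :=
  precondition P i f0 Q f /\
  forall Q' g, precondition P i f0 Q' g ->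
    forall B, database B -> models Q' B g -> models Q B f.

End Semantics.

Section WeakestPrecondition.
Variables (D : pointedType) (k : nat) (ar : 'I_k -> nat).
Implicit Types (A : atom D k) (rho : rule D k) (P Q : program D k).
Implicit Types (c : clause D k) (f g : formula D k) (i : instr D k).
Implicit Types (s q : symb k) (r : 'I_k) (p : symb k -> symb k).

(* Under the first hypothesis all IDBs in play occur in P. *)
Definition new_idb P s := is_idb s && (s \notin program_idbs P).

(* p q is the primed symbol q', for q depending on r. *)
Definition priming P r p :=
  (forall q, depends P q (Edb r) ->
     new_idb P (p q) /\ arity ar (p q) = arity ar q) /\
  (forall q s, depends P q (Edb r) -> depends P s (Edb r) ->
     p q = p s -> q = s).

Definition prime_symb P r p s := if `[< depends P s (Edb r) >] then p s else s.
Definition prime_atom P r p A : atom D k := (prime_symb P r p A.1, A.2).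
Definition prime_rule P r p rho : rule D k :=
  (prime_atom P r p rho.1, [seq (l.1, prime_atom P r p l.2) | l <- rho.2]).

(* P'_r *)
Definition prime_program P r p : program D k :=
  P ++ [seq prime_rule P r p rho
       | rho <- P & `[< depends P (head_symb rho) (Edb r) >]].

(* f[r -> r'] *)
Fixpoint prime_fml P r p f : formula D k :=
  match f with
  | FFalse => FFalse
  | FAtom A => FAtom (prime_atom P r p A)
  | FNot g => FNot (prime_fml P r p g)
  | FAnd g h => FAnd (prime_fml P r p g) (prime_fml P r p h)
  | FOr g h => FOr (prime_fml P r p g) (prime_fml P r p h)
  | FAll x g => FAll x (prime_fml P r p g)
  end.

Definition vatom s (x : seq nat) : atom D k := (s, map Var x).

(* [wp P i f Q g]: g, with its IDBs defined by Q, is wp(i, f), with the IDBs of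
   f defined by P.  It is a relation because the new symbols are arbitrary. *)
Inductive wp : program D k -> instr D k -> formula D k ->
               program D k -> formula D k -> Prop :=
| wp_insert P r x Phi f p : priming P r p ->
    wp P (Insert r x Phi) f
       (prime_program P r p ++
          [:: (vatom (p (Edb r)) x, [:: (true, vatom (Edb r) x)]);
              (vatom (p (Edb r)) x, Phi)])
       (prime_fml P r p f)
| wp_delete P r x Phi f p t : priming P r p ->
    new_idb P t -> arity ar t = ar r ->
    (forall q, depends P q (Edb r) -> p q <> t) ->
    wp P (Delete r x Phi) f
       (prime_program P r p ++
          [:: (vatom (p (Edb r)) x,
                 [:: (true, vatom (Edb r) x); (false, vatom t x)]);
              (vatom t x, Phi)])
       (prime_fml P r p f)
| wp_seq P i1 i2 f Q2 g2 Q1 g1 :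
    wp P i2 f Q2 g2 -> wp Q2 i1 g2 Q1 g1 ->
    wp P (Seq i1 i2) f Q1 g1
| wp_if P cond i1 i2 f Q1 g1 Q2 g2 :
    wp P i1 f Q1 g1 -> wp P i2 f Q2 g2 ->
    (* the new symbols of the two branches are distinct *)
    (forall s, s \in program_idbs Q1 -> s \in program_idbs Q2 ->
       s \in program_idbs P) ->
    wp P (If cond i1 i2) f (Q1 ++ Q2)
       (FOr (FAnd (clause_fml cond) g1) (FAnd (FNot (clause_fml cond)) g2)).

(* That qualifications are conjunctions of literals is built into [instr]. *)
Definition hypothesis1 P i c :=
  forall s, is_idb s -> s \in map (@lit_symb D k) c ++ instr_symbs i ->
    s \in map (@head_symb D k) P.

Fixpoint hypothesis2 P i : Prop :=
  match i with
  | Insert r _ Phi | Delete r _ Phi =>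
      forall l, l \in Phi -> ~ depends P (lit_symb l) (Edb r)
  | Seq i1 i2 | If _ i1 i2 => hypothesis2 P i1 /\ hypothesis2 P i2
  end.

End WeakestPrecondition.

(* Main.v *)
From Stdlib Require Import Relation_Operators Operators_Properties.
From mathcomp Require Import all_boot.
From mathcomp Require Import boolp classical_sets.
Require Import Defs.

(* The iterated fixpoint of a stratified program is its unique stable model, so
   it does not depend on the stratification, and an interpretation is identified
   with the model, even only on a set of symbols closed under the rules, by
   checking that it is stable.  Two consequences:
   - adding rules with new head symbols does not change the old symbols;
   - sending an old symbol s to the extension of s' (of s itself if s does not
     depend on r) in the model of the primed program over B gives a stable model
     of P over the updated database, because r' is exactly the updated r.
   Hence u(B) satisfies f iff B satisfies f[r -> r'].  Composition and
   conditionals reduce to the basic updates by the first consequence.  As an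
   intermediate database may be infinite (unsafe qualifications), the equivalence
   is proved for all instances that respect the arities. *)

Set Implicit Arguments.
Unset Strict Implicit.
Unset Printing Implicit Defensive.

(** * Stable models and the iterated fixpoint *)

Section StableModels.
Variables (D : pointedType) (k : nat).
Implicit Types (P Q : program D k) (B : 'I_k -> set (seq D)).
Implicit Types (J M N : symb k -> set (seq D)) (S : symb k -> Prop).

(* Least fixpoint of the Gelfond-Lifschitz reduct: negated body atoms are
   evaluated in the fixed interpretation N. *)
Inductive reduct_lfp P N J : symb k -> seq D -> Prop :=
| reduct_base s a : J s a -> reduct_lfp P N J s a
| reduct_rule (rho : rule D k) v : rho \in P ->
    (forall A, (true, A) \in rho.2 -> reduct_lfp P N J A.1 (map (eval v) A.2)) ->
    (forall A, (false, A) \in rho.2 -> ~ holds N v A) ->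
    reduct_lfp P N J rho.1.1 (map (eval v) rho.1.2).

(** The reduct involves all symbols; only the comparison is restricted to [S], so that models of
    different programs can be compared on shared symbols. *)
Definition stable_on S P J M :=
  forall s a, S s -> (M s a <-> reduct_lfp P M J s a).

Notation stable := (stable_on (fun=> True)).

Definition rule_closed S P :=
  forall rho s, rho \in P -> S (head_symb rho) ->
    s \in map (@lit_symb D k) rho.2 -> S s.

Lemma mem_lit_symb b A (ls : seq (literal D k)) :
  (b, A) \in ls -> A.1 \in map (@lit_symb D k) ls.
Proof. exact: map_f. Qed.

(** Induction on the stratum: if [M] and [N] agree below [n], then the negated atoms met when
    deriving a fact of stratum at most [n] have the same value in both, and the derivation carries
    over. *)
Lemma stable_on_unique S P J M N sigma :
  stratification sigma P -> rule_closed S P ->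
  stable_on S P J M -> stable_on S P J N ->
  forall s a, S s -> (M s a <-> N s a).
Proof.
move=> strat cl stM stN s a Ss.
pose agree n M1 M2 :=
  forall s a, sigma s < n -> S s -> (M1 s a <-> M2 s a).
have step n M1 M2 : agree n M1 M2 -> forall s a, reduct_lfp P M1 J s a ->
    sigma s <= n -> S s -> reduct_lfp P M2 J s a.
  move=> ag s1 a1; elim=> [s2 a2 Js _ _|rho v rP _ IH neg le_n Sh].
    exact: reduct_base.
  apply: reduct_rule => // A lA.
    apply: IH => //; last by apply: cl rP Sh _; apply: mem_lit_symb lA.
    by apply: leq_trans le_n; apply: (strat _ _ rP lA).
  move=> hA; apply: (neg A lA); apply/ag => //.
    by apply: leq_trans le_n; apply: (strat _ _ rP lA).
  by apply: cl rP Sh _; apply: mem_lit_symb lA.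
suff all_n n : agree n M N by apply: (all_n (sigma s).+1).
elim: n => [|n IH] s1 a1 //; rewrite ltnS => le_n S1.
rewrite (stM _ _ S1) (stN _ _ S1); split=> h.
  exact: step IH _ _ h le_n S1.
by apply: step h le_n S1 => s2 a2 lt2 S2; split=> /(IH s2 a2 lt2 S2).
Qed.

(** A derivation of a fact over [S] uses only rules with head in [S], because the bodies of such
    rules stay in [S]; these rules are available in [Q]. *)
Lemma reduct_lfp_transfer S P Q N J J' :
  rule_closed S P ->
  (forall rho, rho \in P -> S (head_symb rho) -> rho \in Q) ->
  (forall s a, S s -> J s a -> J' s a) ->
  forall s a, reduct_lfp P N J s a -> S s -> reduct_lfp Q N J' s a.
Proof.
move=> cl sub sJ s a; elim=> [s1 a1 /sJ h S1|rho v rP _ IH neg Sh].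
  exact/reduct_base/h.
apply: reduct_rule => //; first exact: sub.
move=> A lA; apply: IH => //; apply: cl rP Sh _; exact: mem_lit_symb lA.
Qed.

Lemma strata_mono sigma P B m n s a :
  m <= n -> strata sigma P B m s a -> strata sigma P B n s a.
Proof.
elim: n => [|n IH]; first by rewrite leqn0 => /eqP->.
rewrite leq_eqVlt => /orP[/eqP->//|]; rewrite ltnS => le_m h.
by apply: lfp_base; apply: IH.
Qed.

(** Rules with head [s] fire only at step [(sigma s).+1], so later steps add no fact about [s]. *)
Lemma strata_complete sigma P B m n s a :
  sigma s < n -> strata sigma P B m s a -> strata sigma P B n s a.
Proof.
move=> lt_n; elim: m => [|m IH] h; first by apply: strata_mono h.
case: (leqP m.+1 n) => [le_n|lt_m]; first by apply: strata_mono h.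
apply: IH; move: h lt_n => /=; case=> // rho v; rewrite mem_filter.
move=> /andP[/eqP sh _] _ _; rewrite -/(head_symb rho) sh => lt_n.
by rewrite ltnNge -ltnS lt_m in lt_n.
Qed.

(** A negated atom is evaluated at a stage where its own, strictly lower, stratum is complete, so
    its value there is its value in the union of all stages. *)
Lemma strata_stable sigma P B : stratification sigma P ->
  stable P (edb_facts B) (fun s a => exists n, strata sigma P B n s a).
Proof.
move=> strat s a _; split.
  case=> n; elim: n s a => [|n IH] s a /=; first exact: reduct_base.
  elim=> [s1 a1 /IH//|rho v]; rewrite mem_filter => /andP[/eqP sh rP] _ IHl neg.
  apply: reduct_rule => // A lA [m hm]; apply: (neg A lA).
  by apply: strata_complete hm; rewrite -sh; apply: (strat _ _ rP lA).
elim=> [s1 a1 h|rho v rP _ IH neg]; first by exists 0.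
exists (sigma (head_symb rho)).+1; apply: lfp_rule => /=.
- by rewrite mem_filter eqxx.
- move=> A lA; have [n hn] := IH A lA.
  apply: (@strata_complete _ _ _ n (sigma (head_symb rho)).+1) => //.
  by rewrite ltnS; apply: (strat _ _ rP lA).
- by move=> A lA h; apply: (neg A lA); exists (sigma (head_symb rho)).
Qed.

Lemma model_strata sigma P B s a : stratification sigma P ->
  (model P B s a <-> exists n, strata sigma P B n s a).
Proof.
move=> strat; split=> [[tau [strat_tau h]]|h]; last by exists sigma.
have cl : rule_closed (fun=> True) P by [].
exact/(stable_on_unique strat cl (strata_stable B strat)
  (strata_stable B strat_tau)).
Qed.

Lemma model_stable P B : stratified P -> stable P (edb_facts B) (model P B).
Proof.
case=> sigma strat; suff -> : model P B =
  (fun s a => exists n, strata sigma P B n s a) by exact: strata_stable.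
by apply/funext => s; apply/seteqP; split=> a /(model_strata _ _ _ strat).
Qed.

Lemma model_fact P B s a : stratified P -> edb_facts B s a -> model P B s a.
Proof. by move=> st h; apply/model_stable => //; apply: reduct_base. Qed.

Lemma model_rule P B (rho : rule D k) v : stratified P -> rho \in P ->
  (forall l, l \in rho.2 -> sat (model P B) v (lit_fml l)) ->
  model P B rho.1.1 (map (eval v) rho.1.2).
Proof.
move=> st rP h; apply/model_stable => //; apply: reduct_rule => // A lA.
  by apply/model_stable => //; apply: (h _ lA).
exact: (h _ lA).
Qed.

Lemma model_inv P B s a : stratified P -> model P B s a ->
  edb_facts B s a \/ exists rho v, [/\ rho \in P, s = rho.1.1,
    a = map (eval v) rho.1.2 &
    forall l, l \in rho.2 -> sat (model P B) v (lit_fml l)].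
Proof.
move=> st /(model_stable B st _ I) [s1 a1 h|rho v rP pos neg]; first by left.
right; exists rho, v; split=> // -[[] A] lA /=; last exact: neg.
by apply/(model_stable B st _ I); apply: pos.
Qed.

Lemma model_edb ar P B r a : wf_program ar P -> stratified P ->
  (model P B (Edb r) a <-> B r a).
Proof.
move=> wfP st; split=> [|h]; last exact: model_fact.
case/(model_inv st) => // -[rho [v [/(allP wfP)/and3P[idb _ _] e _ _]]].
by rewrite /head_symb -e in idb.
Qed.

End StableModels.

(** * Adding rules that define new symbols *)

Section Extension.
Variables (D : pointedType) (k : nat).
Implicit Types (P Q : program D k) (B : 'I_k -> set (seq D)).
Implicit Types (f g : formula D k) (i : instr D k) (s : symb k).

Fixpoint fml_symbs f : seq (symb k) :=
  match f with
  | FFalse => [::]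
  | FAtom A => [:: A.1]
  | FNot g | FAll _ g => fml_symbs g
  | FAnd g h | FOr g h => fml_symbs g ++ fml_symbs h
  end.

Definition known P s := ~~ new_idb P s.

(** Only the heads of the added rules must be new; their bodies are unrestricted. *)
Definition extends P Q :=
  {subset P <= Q} /\
  forall rho, rho \in Q -> rho \in P \/ new_idb P (head_symb rho).

Lemma mem_program_idbs P s : reflect
  (is_idb s /\ exists2 rho, rho \in P & s \in rule_symbs rho)
  (s \in program_idbs P).
Proof.
rewrite mem_filter; apply: (iffP andP) => -[? h]; split=> //.
  by have [_ /mapP[rho rP ->] ?] := flattenP h; exists rho.
by case: h => rho rP h; apply/flattenP; exists (rule_symbs rho) => //; apply: map_f.
Qed.

Lemma known_rule P rho s : rho \in P -> s \in rule_symbs rho -> known P s.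
Proof.
move=> rP sr; rewrite /known /new_idb negb_and negbK; case: (boolP (is_idb s)) => //= h.
by apply/mem_program_idbs; split=> //; exists rho.
Qed.

Lemma known_head P rho : rho \in P -> known P (head_symb rho).
Proof. by move=> rP; apply: known_rule rP _; rewrite mem_head. Qed.

Lemma known_body P rho s :
  rho \in P -> s \in map (@lit_symb D k) rho.2 -> known P s.
Proof. by move=> rP sb; apply: known_rule rP _; rewrite inE sb orbT. Qed.

Lemma program_idbs_sub P Q :
  {subset P <= Q} -> {subset program_idbs P <= program_idbs Q}.
Proof.
move=> sub s /mem_program_idbs[idb [rho rP sr]]; apply/mem_program_idbs.
by split=> //; exists rho => //; apply: sub.
Qed.

Lemma known_sub P Q s : {subset P <= Q} -> known P s -> known Q s.
Proof.
move=> sub; rewrite /known /new_idb !negb_and !negbK => /orP[->//|h].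
by rewrite (program_idbs_sub sub h) orbT.
Qed.

Lemma new_idb_sub P Q s : {subset P <= Q} -> new_idb Q s -> new_idb P s.
Proof. by move=> sub; apply: contraLR; apply: known_sub. Qed.

Lemma extends_trans P Q R : extends P Q -> extends Q R -> extends P R.
Proof.
move=> [sPQ PQ] [sQR QR]; split=> [rho /sPQ/sQR//|rho /QR[/PQ//|h]].
by right; apply: new_idb_sub h.
Qed.

Lemma extends_rule P Q rho : extends P Q -> rho \in Q ->
  known P (head_symb rho) -> rho \in P.
Proof. by move=> [_ PQ] /PQ[//|h]; rewrite /known h. Qed.

Lemma stratification_sub P Q sigma :
  {subset P <= Q} -> stratification sigma Q -> stratification sigma P.
Proof. by move=> sub st rho l /sub; apply: st. Qed.

Lemma stratified_sub P Q : {subset P <= Q} -> stratified Q -> stratified P.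
Proof. by move=> sub [sigma st]; exists sigma; apply: stratification_sub st. Qed.

Lemma rule_closed_known P : rule_closed (known P) P.
Proof. by move=> rho s rP _; apply: known_body. Qed.

(** The model of [Q] is stable for [P] on the known symbols: a rule of [Q] with a known head belongs
    to [P], and its body is then known as well. *)
Lemma model_extends P Q B s a : stratified Q -> extends P Q -> known P s ->
  (model Q B s a <-> model P B s a).
Proof.
move=> stQ PQ; have stP := stratified_sub PQ.1 stQ.
have [sigma st] := stP.
move: s a; apply: (stable_on_unique (J := edb_facts B) st (@rule_closed_known P)).
  move=> s a ks; rewrite (model_stable B stQ a I); split=> h.
    apply: (reduct_lfp_transfer (S := known P) _ _ _ h) => //.
      by move=> rho s1 /(extends_rule PQ) rP /rP; apply: known_body.
    by move=> rho; apply: extends_rule.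
  apply: (reduct_lfp_transfer (S := known P) _ _ _ h ks) => //; first exact: rule_closed_known.
  by move=> rho /PQ.1.
by move=> s a _; apply: model_stable.
Qed.

Lemma sat_ext (I1 I2 : symb k -> set (seq D)) v f :
  (forall s a, s \in fml_symbs f -> (I1 s a <-> I2 s a)) ->
  (sat I1 v f <-> sat I2 v f).
Proof.
elim: f v => [|A|g IH|g IHg h IHh|g IHg h IHh|x g IH] v //= e.
- by apply: e; rewrite mem_head.
- by rewrite IH.
- by rewrite IHg ?IHh // => s a sg; apply: e; rewrite mem_cat sg ?orbT.
- by rewrite IHg ?IHh // => s a sg; apply: e; rewrite mem_cat sg ?orbT.
- by split=> sg d; have := sg d; rewrite IH.
Qed.

Lemma models_extends P Q B f : stratified Q -> extends P Q ->
  {in fml_symbs f, forall s, known P s} -> (models Q B f <-> models P B f).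
Proof.
move=> st PQ kf; have e v : sat (model Q B) v f <-> sat (model P B) v f.
  by apply: sat_ext => s a /kf ks; apply: model_extends.
by split=> h v; apply/e.
Qed.

Lemma fml_symbs_lit (l : literal D k) : fml_symbs (lit_fml l) = [:: lit_symb l].
Proof. by case: l => [[] A]. Qed.

Lemma fml_symbs_clause (c : clause D k) :
  fml_symbs (clause_fml c) = map (@lit_symb D k) c.
Proof.
rewrite /clause_fml; elim: (undup _) => //=; elim: c => //= l c ->.
by rewrite fml_symbs_lit.
Qed.

Lemma answers_extends P Q B x Phi : stratified Q -> extends P Q ->
  {in map (@lit_symb D k) Phi, forall s, known P s} ->
  answers Q B x Phi = answers P B x Phi.
Proof.
move=> st PQ kPhi; have e v l : l \in Phi ->
    (sat (model Q B) v (lit_fml l) <-> sat (model P B) v (lit_fml l)).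
  move=> lPhi; apply: sat_ext => s a; rewrite fml_symbs_lit inE => /eqP->.
  by apply: model_extends => //; apply/kPhi/map_f.
by apply/seteqP; split=> a [v [-> h]]; exists v; split=> // l lPhi; apply/e => //; apply: h.
Qed.

Lemma exec_extends P Q i B : stratified Q -> extends P Q ->
  {in instr_symbs i, forall s, known P s} -> exec Q i B = exec P i B.
Proof.
move=> st PQ; elim: i B => [r x Phi|r x Phi|i1 IH1 i2 IH2|c i1 IH1 i2 IH2] B /= ki.
- by rewrite (answers_extends _ _ st PQ).
- by rewrite (answers_extends _ _ st PQ).
- by rewrite IH1 ?IH2 // => s si; apply: ki; rewrite mem_cat si ?orbT.
- have -> : models Q B (clause_fml c) = models P B (clause_fml c).
    apply/propext; apply: models_extends => // s.
    by rewrite fml_symbs_clause => sc; apply: ki; rewrite mem_cat sc.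
  by rewrite IH1 ?IH2 // => s si; apply: ki; rewrite !mem_cat si ?orbT.
Qed.

End Extension.

(** * The primed program and its model *)

Section Priming.
Variables (D : pointedType) (k : nat) (ar : 'I_k -> nat).
Implicit Types (P Q : program D k) (B : 'I_k -> set (seq D)).
Implicit Types (f g : formula D k) (s q : symb k) (r : 'I_k).
Implicit Types (p : symb k -> symb k).

Lemma depends_refl P s : depends P s s.
Proof. by apply: t_step; left. Qed.

Lemma depends_rule P rho s q : rho \in P -> s \in map (@lit_symb D k) rho.2 ->
  depends P s q -> depends P (head_symb rho) q.
Proof.
by move=> rP sb; apply: t_trans; apply: t_step; right; exists rho.
Qed.

Lemma depends_inv P s q : depends P s q ->
  s = q \/ exists2 rho, rho \in P & head_symb rho = s.
Proof.
move/clos_trans_t1n_iff; elim=> [s1 s2|s1 s2 s3] [->|[rho [rP <- _]]]; try by left.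
- by right; exists rho.
- by [].
- by move=> *; right; exists rho.
Qed.

Lemma depends_edb P r' r : wf_program ar P ->
  depends P (Edb r') (Edb r) -> r' = r.
Proof.
move=> wfP /depends_inv[[]//|[rho /(allP wfP)/and3P[idb _ _] e]].
by rewrite e in idb.
Qed.

Lemma prime_symb_dep P r p s :
  depends P s (Edb r) -> prime_symb P r p s = p s.
Proof. by move=> d; rewrite /prime_symb asboolT. Qed.

Lemma prime_symb_nodep P r p s :
  ~ depends P s (Edb r) -> prime_symb P r p s = s.
Proof. by move=> d; rewrite /prime_symb asboolF. Qed.

(** A primed symbol is new, so it cannot coincide with a known unprimed one; two primed symbols are
    separated by [priming]. *)
Lemma prime_symb_inj P r p s q : priming ar P r p -> known P s -> known P q ->
  prime_symb P r p s = prime_symb P r p q -> s = q.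
Proof.
move=> [new inj] ks kq; rewrite /prime_symb.
case: asboolP => ds; case: asboolP => dq //; first exact: inj.
- by move=> e; move: kq; rewrite /known -e (new _ ds).1.
- by move=> e; move: ks; rewrite /known e (new _ dq).1.
Qed.

Lemma arity_prime_symb P r p s : priming ar P r p ->
  arity ar (prime_symb P r p s) = arity ar s.
Proof.
by move=> [new _]; rewrite /prime_symb; case: asboolP => // /new[].
Qed.

Lemma wf_prime_atom P r p A : priming ar P r p ->
  wf_atom ar (prime_atom P r p A : atom D k) = wf_atom ar A.
Proof. by move=> pr; rewrite /wf_atom /= arity_prime_symb. Qed.

Lemma mem_prime_program P r p rho : rho \in prime_program P r p ->
  rho \in P \/ exists rho0, [/\ rho0 \in P,
    depends P (head_symb rho0) (Edb r) & rho = prime_rule P r p rho0].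
Proof.
rewrite mem_cat => /orP[|/mapP[rho0]]; first by left.
by rewrite mem_filter => /andP[/asboolP d rP] ->; right; exists rho0.
Qed.

Lemma prime_rule_mem P r p rho : rho \in P ->
  depends P (head_symb rho) (Edb r) ->
  prime_rule P r p rho \in prime_program P r p.
Proof.
by move=> rP d; rewrite mem_cat map_f ?orbT // mem_filter rP andbT; apply/asboolP.
Qed.

Lemma wf_prime_program P r p : priming ar P r p ->
  wf_program ar P -> wf_program ar (prime_program P r p).
Proof.
move=> pr wfP; apply/allP => rho /mem_prime_program[/(allP wfP)//|].
case=> rho0 [/(allP wfP)/and3P[_ wfh wfb] d ->].
apply/and3P; split.
- by rewrite /head_symb /= prime_symb_dep //; case/andP: (pr.1 _ d).1.
- by rewrite wf_prime_atom.
- by rewrite /wf_lits all_map; apply: sub_all wfb => l /=; rewrite wf_prime_atom.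
Qed.

Lemma extends_prime P r p (extra : program D k) : priming ar P r p ->
  (forall rho, rho \in extra -> new_idb P (head_symb rho)) ->
  extends P (prime_program P r p ++ extra).
Proof.
move=> pr ne; split=> rho; first by rewrite !mem_cat => ->.
rewrite mem_cat => /orP[/mem_prime_program[|[rho0 [rP d ->]]]|/ne]; try by [left|right].
by right; rewrite /head_symb /= prime_symb_dep //; apply: (pr.1 _ d).1.
Qed.

Lemma fml_symbs_prime P r p f :
  fml_symbs (prime_fml P r p f) = map (prime_symb P r p) (fml_symbs f).
Proof. by elim: f => //= [g -> h ->|g -> h ->]; rewrite map_cat. Qed.

Lemma free_vars_prime P r p f : free_vars (prime_fml P r p f) = free_vars f.
Proof. by elim: f => //= [g -> h ->|g -> h ->|x g ->]. Qed.

Lemma wf_prime_fml P r p f : priming ar P r p ->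
  wf_fml ar (prime_fml P r p f) = wf_fml ar f.
Proof.
move=> pr; elim: f => //= [A|g -> h ->|g -> h ->] //; exact: wf_prime_atom.
Qed.

Lemma sat_prime P r p (I : symb k -> set (seq D)) v f :
  sat I v (prime_fml P r p f) <-> sat (fun s => I (prime_symb P r p s)) v f.
Proof.
elim: f v => [|A|g IH|g IHg h IHh|g IHg h IHh|x g IH] v //=.
- by rewrite IH.
- by rewrite IHg IHh.
- by rewrite IHg IHh.
- by split=> sg d; apply/IH.
Qed.

(** A symbol other than [Edb r] that depends on [r] heads a rule of [P], whose primed copy makes the
    primed symbol known. [Edb r] may head no rule, hence the separate hypothesis on [p (Edb r)]. *)
Lemma known_prime P r p Q s : priming ar P r p ->
  {subset prime_program P r p <= Q} -> known Q (p (Edb r)) ->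
  known P s -> known Q (prime_symb P r p s).
Proof.
move=> pr sub kr ks; rewrite /prime_symb; case: asboolP => d; last first.
  by apply: known_sub ks => rho rP; apply: sub; rewrite mem_cat rP.
case: (depends_inv d) => [->//|[rho rP hs]].
have := known_head (sub _ (prime_rule_mem p rP _)).
by rewrite /head_symb /= -/(head_symb rho) hs prime_symb_dep //; apply.
Qed.

(* The primed symbols are placed above all strata of the qualification, in
   the order of their originals; the other new symbols just below them. *)
Lemma prime_stratification P r p sigma m : priming ar P r p ->
  stratification sigma P -> exists sigma', [/\
    stratification sigma' (prime_program P r p),
    forall s, known P s -> sigma' s = sigma s,
    forall q, depends P q (Edb r) -> sigma' (p q) = m.+1 + sigma q &
    forall t, new_idb P t -> (forall q, depends P q (Edb r) -> p q <> t) ->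
      sigma' t = m].
Proof.
move=> pr st.
(* [pselect] and [cid] recover the original of a primed symbol, which is unique because [p] is
   injective on the symbols depending on [r]. *)
pose sigma' s :=
  if pselect (exists q, depends P q (Edb r) /\ p q = s) is left e
  then m.+1 + sigma (projT1 (cid e))
  else if new_idb P s then m else sigma s.
have old s : known P s -> sigma' s = sigma s.
  move=> ks; rewrite /sigma'; case: pselect => [[q [d e]]|_].
    by exfalso; move: ks; rewrite /known -e (pr.1 _ d).1.
  by rewrite (negbTE ks).
have prm q : depends P q (Edb r) -> sigma' (p q) = m.+1 + sigma q.
  move=> d; rewrite /sigma'; case: pselect => [e|[]]; last by exists q.
  by case: (cid e) => q' /= [d' /(pr.2 _ _ d' d)->].
exists sigma'; split=> //; last first.
  move=> t nt np; rewrite /sigma'; case: pselect => [[q [d e]]|_].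
    by case: (np _ d).
  by rewrite nt.
move=> rho l /mem_prime_program[rP lr|[rho0 [rP d ->]] /mapP[l0 lr ->]].
  rewrite !old; [exact: st|exact: known_head|exact/(known_body rP)/map_f].
rewrite /head_symb /lit_symb /= -/(head_symb rho0) -/(lit_symb l0).
rewrite (prime_symb_dep p d) (prm _ d).
(* The head is raised by [m.+1] and a body symbol by [m.+1] or [0], so weak and strict inequalities
   both survive. *)
have -> : sigma' (prime_symb P r p (lit_symb l0)) =
    (if `[< depends P (lit_symb l0) (Edb r) >] then m.+1 else 0)
      + sigma (lit_symb l0).
  rewrite /prime_symb; case: asboolP => [/prm//|_].
  by rewrite old //; apply/(known_body rP)/map_f.
have := st _ _ rP lr; case: l0.1 => h.
  by apply: leq_add h; case: asboolP.
by rewrite -addnS; apply: leq_add h; case: asboolP.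
Qed.

(** Stated for any [extra], to serve insertion and deletion alike. The extra rules may define
    [p (Edb r)] and other new symbols but no further primed symbol, so derivations of primed IDBs
    mirror those of their originals. *)
Lemma prime_model P r p (extra : program D k) B B' s a :
  priming ar P r p -> wf_program ar P ->
  let Q := prime_program P r p ++ extra in stratified Q ->
  (forall rho, rho \in extra -> new_idb P (head_symb rho) /\
     forall q, depends P q (Edb r) -> head_symb rho = p q -> q = Edb r) ->
  (forall r', r' != r -> B' r' = B r') ->
  (forall a, model Q B (p (Edb r)) a <-> B' r a) ->
  known P s -> (model Q B (prime_symb P r p s) a <-> model P B' s a).
Proof.
move=> pr wfP Q stQ ex B'E B'r.
have PQ : extends P Q by apply: extends_prime => // rho /ex[].
have stP := stratified_sub PQ.1 stQ.
have [sigma st] := stP.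
have priE s1 : s1 = Edb r -> prime_symb P r p s1 = p (Edb r).
  by move=> ->; rewrite prime_symb_dep //; apply: depends_refl.
have edbE r' : r' != r -> prime_symb P r p (Edb r') = Edb r'.
  by move=> ne; rewrite prime_symb_nodep // => /(depends_edb wfP) e; rewrite e eqxx in ne.
have bodyE rho A b : rho \in P -> ~ depends P (head_symb rho) (Edb r) ->
    (b, A) \in rho.2 -> prime_symb P r p A.1 = A.1.
  move=> rP nd lA; rewrite prime_symb_nodep // => d.
  by apply: nd; apply: depends_rule rP _ d; apply: mem_lit_symb lA.
move: s a; apply: (stable_on_unique (J := edb_facts B') st
  (@rule_closed_known _ _ P) (M := fun s => model Q B (prime_symb P r p s))); last first.
  by move=> s a _; apply: model_stable.
(* A derivation in [P] over [B'] is replayed in [Q] over [B], using the primed copy of each rule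
   whose head depends on [r]. *)
move=> s a ks; split; last first.
  move=> h; elim: h ks => {s a} [[r' a|//] h _|rho v rP _ IH neg _].
    case: (eqVneq r' r) h => [->|ne] /=; first by rewrite priE // B'r.
    by rewrite (B'E _ ne) edbE // => h; apply: model_fact.
  have [d|nd] := pselect (depends P (head_symb rho) (Edb r)).
    apply: (@model_rule _ _ Q B (prime_rule P r p rho) v) => //.
      by rewrite mem_cat prime_rule_mem.
    move=> _ /mapP[[[] A] lA ->] /=; last exact: neg.
    by apply: IH => //; apply/(known_body rP)/mem_lit_symb/lA.
  rewrite prime_symb_nodep //.
  apply: (@model_rule _ _ Q B rho v) => // [|[[] A] lA]; first exact: PQ.1.
    rewrite /= /holds -(bodyE _ _ _ rP nd lA).
    by apply: IH => //; apply/(known_body rP)/mem_lit_symb/lA.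
  by have := neg _ lA; rewrite /= /holds (bodyE _ _ _ rP nd lA).
move/(model_stable B stQ _ I); move e: (prime_symb P r p s) => s' h.
elim: h s e ks => {s' a} [s' a h|rho v rQ pos IH neg] s e ks.
  (* An EDB is never a primed symbol, so [s] is an EDB other than [r], on which [B] and [B']
     agree. *)
  case: s' h e => // r' h e.
  have nd : ~ depends P s (Edb r).
    by move=> d; have := (pr.1 _ d).1; rewrite -(prime_symb_dep p d) e.
  rewrite prime_symb_nodep // in e; rewrite e in nd *.
  apply: reduct_base; rewrite /= B'E //; apply/eqP => er.
  by apply: nd; rewrite er; apply: depends_refl.
have posQ A : (true, A) \in rho.2 -> holds (model Q B) v A.
  by move=> lA; apply/(model_stable B stQ _ I)/pos.
(* A rule of [P] has a known, hence unprimed, head; a primed rule is traced back to its original by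
   injectivity; an extra rule whose head is the image of [s] defines [p (Edb r)], which is
   [B' r]. *)
move: (rQ); rewrite mem_cat => /orP[/mem_prime_program[rP|[rho0 [rP d re]]]|rE].
- have nd : ~ depends P s (Edb r).
    move=> d; have := known_head rP.
    by rewrite /known /head_symb -e prime_symb_dep // (pr.1 _ d).1.
  rewrite prime_symb_nodep // in e; rewrite e in nd *.
  apply: reduct_rule => // A lA; have kA := known_body rP (mem_lit_symb lA).
    by apply: IH => //; apply: bodyE lA.
  by have := neg _ lA; rewrite /holds (bodyE _ _ _ rP nd lA).
- have es : s = head_symb rho0.
    by apply: prime_symb_inj pr ks (known_head rP) _; rewrite e re.
  rewrite es re; apply: (@reduct_rule _ _ P _ _ rho0 v) => // A lA.
    have lA' : (true, prime_atom P r p A) \in rho.2.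
      by rewrite re; apply/mapP; exists (true, A).
    by apply: (IH _ lA') => //; apply/(known_body rP)/mem_lit_symb/lA.
  have lA' : (false, prime_atom P r p A) \in rho.2.
    by rewrite re; apply/mapP; exists (false, A).
  exact: neg lA'.
- have [nh hq] := ex _ rE.
  have d : depends P s (Edb r).
    apply: contrapT => nd; rewrite prime_symb_nodep // in e.
    by move: ks; rewrite /known e -/(head_symb rho) nh.
  rewrite prime_symb_dep // in e; have es := hq _ d (esym e).
  rewrite es in e *; apply/reduct_base/B'r; rewrite e.
  by apply/(model_stable B stQ _ I); apply: reduct_rule.
Qed.

End Priming.

(** * Free variables and closed formulas *)

Section Sentences.
Variables (D : pointedType) (k : nat) (ar : 'I_k -> nat).
Implicit Types (c : clause D k) (f : formula D k).

Lemma sat_free_vars (I : symb k -> set (seq D)) f v w :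
  {in free_vars f, v =1 w} -> (sat I v f <-> sat I w f).
Proof.
elim: f v w => [|A|g IH|g IHg h IHh|g IHg h IHh|x g IH] v w //= e.
- rewrite /holds; suff -> : map (eval v) A.2 = map (eval w) A.2 by [].
  apply/eq_in_map => -[y|//] yA; apply: e; apply/flattenP.
  by exists [:: y]; rewrite ?mem_head //; apply/mapP; exists (Var y).
- by rewrite (IH v w).
- by rewrite (IHg v w) ?(IHh v w) // => y yg; apply: e; rewrite mem_cat yg ?orbT.
- by rewrite (IHg v w) ?(IHh v w) // => y yg; apply: e; rewrite mem_cat yg ?orbT.
- have ext d y : y \in free_vars g ->
      (if y == x then d else v y) = (if y == x then d else w y).
    by case: eqVneq => // yx yg; apply: e; rewrite mem_filter /= yx.
  by split=> sg d; have := sg d; apply IH => y yg; rewrite ext.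
Qed.

(** [models] quantifies over valuations, so it does not commute with disjunction and negation in
    general; for a closed formula, such as a condition, a single valuation decides. *)
Lemma closed_models P (B : 'I_k -> set (seq D)) f v :
  closed f -> (sat (model P B) v f <-> models P B f).
Proof.
move=> cf; split=> [h w|]; last exact.
by apply: (sat_free_vars _ _).1 h; rewrite cf.
Qed.

Lemma clause_closed c : closed (clause_fml c).
Proof.
suff nofree y : y \notin free_vars (clause_fml c).
  by rewrite /closed; case: (free_vars _) nofree => // y vs /(_ y); rewrite mem_head.
rewrite /clause_fml; set vs := undup _; set b := foldr _ _ (map _ _).
have sub : y \in free_vars b -> y \in vs.
  rewrite mem_undup /b {vs b}; elim: c => //= l c IH; rewrite !mem_cat.
  by case/orP => [|/IH->]; [case: l => [[] A] /= ->|rewrite orbT].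
have : y \in free_vars (foldr (@FAll D k) b vs) -> y \in free_vars b /\ y \notin vs.
  elim: vs {sub} => //= x vs IH; rewrite mem_filter inE negb_or => /andP[/= yx].
  by move=> /IH[-> ->]; rewrite yx.
by move=> h; apply/negP => /h[/sub->].
Qed.

Lemma wf_clause_fml c : wf_fml ar (clause_fml c) = wf_lits ar c.
Proof.
by rewrite /clause_fml; elim: (undup _) => //=; elim: c => //= -[[] A] c ->.
Qed.

End Sentences.

(** * Correctness of the preconditions *)

Section Correctness.
Variables (D : pointedType) (k : nat) (ar : 'I_k -> nat).
Implicit Types (P Q : program D k) (B : 'I_k -> set (seq D)).
Implicit Types (f g : formula D k) (i : instr D k) (s q t : symb k).
Implicit Types (r : 'I_k) (p : symb k -> symb k).

Definition respects_arity B := forall r a, B r a -> size a = ar r.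

Lemma exec_respects_arity P i B :
  wf_instr ar i -> respects_arity B -> respects_arity (exec P i B).
Proof.
elim: i B => [r x Phi|r x Phi|i1 IH1 i2 IH2|c i1 IH1 i2 IH2] B /=.
- move=> /and3P[/eqP sx _ _] arB r' a; case: eqVneq => [->|_]; last exact: arB.
  by case=> [/arB//|[v [-> _]]]; rewrite size_map.
- move=> _ arB r' a; case: eqVneq => _; last exact: arB.
  by case=> /arB.
- by move=> /andP[w1 w2] arB; apply: IH2 => //; apply: IH1.
- by move=> /and3P[_ w1 w2] arB; case: asboolP => _; [apply: IH1|apply: IH2].
Qed.

(** This is what lets the rule [r'(x) <- r(x)] reach every tuple of [r]: distinct variables can take
    arbitrary values. *)
Lemma tuple_valuation (x : seq nat) (a : seq D) :
  uniq x -> size a = size x -> exists v, a = map v x.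
Proof.
move=> ux sa; exists (fun y => nth point a (index y x)).
apply: (@eq_from_nth _ point); rewrite ?size_map // => n; rewrite sa => ltn.
by rewrite (nth_map 0) // index_uniq.
Qed.

Lemma map_eval_vatom v s (x : seq nat) :
  map (eval v) (vatom D s x).2 = map v x.
Proof. by rewrite -map_comp. Qed.

(** No rule of [P] has the new head [u], and a primed rule with head [u] would come from a rule of
    [P] with head [Edb r], which well-formedness excludes. *)
Lemma new_symb_model P r p (extra : program D k) B u a :
  priming ar P r p -> wf_program ar P ->
  let Q := prime_program P r p ++ extra in stratified Q -> new_idb P u ->
  (forall q, depends P q (Edb r) -> p q = u -> q = Edb r) ->
  model Q B u a -> exists rho v, [/\ rho \in extra, u = rho.1.1,
    a = map (eval v) rho.1.2 &
    forall l, l \in rho.2 -> sat (model Q B) v (lit_fml l)].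
Proof.
move=> pr wfP Q stQ nu pu /(model_inv stQ)[|[rho [v [rQ e ea h]]]].
  by case: (u) nu.
move: (rQ); rewrite mem_cat => /orP[/mem_prime_program[rP|[rho0 [rP d re]]]|rE].
- by have := known_head rP; rewrite /known /head_symb -e nu.
- have := allP wfP _ rP; rewrite /wf_rule (pu (head_symb rho0)) //.
  by rewrite e re /= prime_symb_dep.
- by exists rho, v.
Qed.

Definition insert_rules r p (x : seq nat) (Phi : seq (literal D k)) :=
  [:: (vatom D (p (Edb r)) x, [:: (true, vatom D (Edb r) x)]);
      (vatom D (p (Edb r)) x, Phi)].

Definition delete_rules r p t (x : seq nat) (Phi : seq (literal D k)) :=
  [:: (vatom D (p (Edb r)) x,
         [:: (true, vatom D (Edb r) x); (false, vatom D t x)]);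
      (vatom D t x, Phi)].

Lemma prime_edb_new P r p : priming ar P r p -> new_idb P (p (Edb r)).
Proof. by move=> pr; apply: (pr.1 _ (depends_refl P _)).1. Qed.

Lemma prime_edb_inj P r p q : priming ar P r p ->
  depends P q (Edb r) -> p q = p (Edb r) -> q = Edb r.
Proof. by move=> pr d; apply: pr.2 => //; apply: depends_refl. Qed.

Lemma insert_rules_new P r p x Phi : priming ar P r p ->
  forall rho, rho \in insert_rules r p x Phi -> new_idb P (head_symb rho) /\
    forall q, depends P q (Edb r) -> head_symb rho = p q -> q = Edb r.
Proof.
move=> pr rho rE; have -> : head_symb rho = p (Edb r).
  by move: rE; rewrite !inE => /orP[] /eqP->.
by split=> [|q d /esym]; [exact: prime_edb_new pr|exact: prime_edb_inj pr d].
Qed.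

Lemma delete_rules_new P r p t x Phi : priming ar P r p -> new_idb P t ->
  (forall q, depends P q (Edb r) -> p q <> t) ->
  forall rho, rho \in delete_rules r p t x Phi -> new_idb P (head_symb rho) /\
    forall q, depends P q (Edb r) -> head_symb rho = p q -> q = Edb r.
Proof.
move=> pr nt pt rho rE; have [->|->] : head_symb rho = p (Edb r) \/ head_symb rho = t.
  by move: rE; rewrite !inE => /orP[] /eqP->; [left|right].
- by split=> [|q d /esym]; [exact: prime_edb_new pr|exact: prime_edb_inj pr d].
- by split=> // q d /esym/(pt _ d).
Qed.

Lemma insert_model P r p x Phi B a : priming ar P r p -> wf_program ar P ->
  let Q := prime_program P r p ++ insert_rules r p x Phi in
  stratified Q -> wf_program ar Q -> size x = ar r -> uniq x ->
  respects_arity B ->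
  (model Q B (p (Edb r)) a <-> B r a \/ answers Q B x Phi a).
Proof.
move=> pr wfP Q stQ wfQ sx ux arB; split.
  case/(new_symb_model pr wfP stQ (prime_edb_new pr)) => [q|rho].
    exact: (prime_edb_inj pr).
  case=> v [rE _ ->]; move: rE; rewrite !inE => /orP[] /eqP-> h.
    by left; apply/(model_edb B _ _ wfQ stQ); apply: (h _ (mem_head _ _)).
  by right; exists v; rewrite map_eval_vatom.
case=> [Ba|[v [-> h]]]; rewrite -?(map_eval_vatom v (p (Edb r)) x).
  have [|v ev] := tuple_valuation (a := a) ux; first by rewrite (arB _ _ Ba).
  rewrite ev -(map_eval_vatom v (p (Edb r)) x).
  apply: (@model_rule _ _ Q B
    (vatom D (p (Edb r)) x, [:: (true, vatom D (Edb r) x)]) v) => //.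
    by rewrite !(mem_cat, inE) eqxx !orbT.
  move=> l; rewrite inE => /eqP-> /=; rewrite /holds map_eval_vatom -ev.
  exact: model_fact.
apply: (@model_rule _ _ Q B (vatom D (p (Edb r)) x, Phi) v) => //.
by rewrite !(mem_cat, inE) eqxx !orbT.
Qed.

Lemma delete_model P r p t x Phi B a : priming ar P r p -> wf_program ar P ->
  new_idb P t -> (forall q, depends P q (Edb r) -> p q <> t) ->
  let Q := prime_program P r p ++ delete_rules r p t x Phi in
  stratified Q -> wf_program ar Q -> size x = ar r -> uniq x ->
  respects_arity B ->
  (model Q B (p (Edb r)) a <-> B r a /\ ~ answers Q B x Phi a).
Proof.
move=> pr wfP nt pt Q stQ wfQ sx ux arB.
have tr : p (Edb r) <> t by apply/pt/depends_refl.
(* The rule for [t] projects away the variables of [Phi] outside [x], so [~ t(x)] negates the whole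
   existentially read qualification. *)
have tE b : model Q B t b <-> answers Q B x Phi b.
  split=> [|[v [-> h]]].
    case/(new_symb_model pr wfP stQ nt) => [q d /pt|rho [v [rE tE ->]]].
      by move/(_ d).
    move: rE tE; rewrite !inE => /orP[] /eqP-> /= e h; first by case: tr.
    by exists v; rewrite map_eval_vatom.
  rewrite -(map_eval_vatom v t x).
  apply: (@model_rule _ _ Q B (vatom D t x, Phi) v) => //.
  by rewrite !(mem_cat, inE) eqxx !orbT.
split.
  case/(new_symb_model pr wfP stQ (prime_edb_new pr)) => [q|rho].
    exact: (prime_edb_inj pr).
  case=> v [rE e ->]; move: rE e; rewrite !inE => /orP[] /eqP-> /= e h; last by case: tr.
  split.
    by apply/(model_edb B _ _ wfQ stQ); apply: (h _ (mem_head _ _)).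
  move/tE; apply: (h (false, vatom D t x)); by rewrite !inE eqxx orbT.
case=> Ba na; have [|v ev] := tuple_valuation (a := a) ux.
  by rewrite (arB _ _ Ba).
rewrite ev -(map_eval_vatom v (p (Edb r)) x).
apply: (@model_rule _ _ Q B (vatom D (p (Edb r)) x,
    [:: (true, vatom D (Edb r) x); (false, vatom D t x)]) v) => //.
  by rewrite !(mem_cat, inE) eqxx !orbT.
move=> l; rewrite !inE => /orP[] /eqP-> /=; rewrite /holds map_eval_vatom -ev.
  exact: model_fact.
by move/tE.
Qed.

(** A rule of [Q2] outside [P] has a head new for [P]; disjointness of the symbols added by the two
    branches makes it new for [Q1]. *)
Lemma extends_cat P Q1 Q2 : extends P Q1 -> extends P Q2 ->
  (forall s, s \in program_idbs Q1 -> s \in program_idbs Q2 ->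
     s \in program_idbs P) ->
  extends Q1 (Q1 ++ Q2).
Proof.
move=> [sP1 _] [_ e2] dis; split=> rho; rewrite mem_cat; first by move->.
case/orP => [|r2]; first by left.
case: (e2 _ r2) => [/sP1|/andP[idb nP]]; first by left.
right; rewrite /new_idb idb /=; apply: contra nP => h1; apply: dis => //.
by apply/mem_program_idbs; split=> //; exists rho => //; rewrite mem_head.
Qed.

Lemma extends_perm P Q1 Q2 : Q1 =i Q2 -> extends P Q1 -> extends P Q2.
Proof. by move=> e [s h]; split=> rho; rewrite -e; [exact: s|exact: h]. Qed.

Lemma wp_extends P i f Q g : wp ar P i f Q g -> extends P Q.
Proof.
elim=> {P i f Q g}.
- by move=> P r x Phi f p pr; apply: (extends_prime pr) => rho /(insert_rules_new pr)[].
- move=> P r x Phi f p t pr nt _ pt.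
  by apply: (extends_prime pr) => rho /(delete_rules_new pr nt pt)[].
- by move=> P i1 i2 f Q2 g2 Q1 g1 _ + _; apply: extends_trans.
- move=> P c i1 i2 f Q1 g1 Q2 g2 _ [s1 e1] _ [s2 e2] _; split=> rho.
    by rewrite mem_cat => /s1->.
  by rewrite mem_cat => /orP[/e1|/e2].
Qed.

(** Preserving the strata of the known symbols is what allows the two branches of a conditional to
    be stratified together. *)
Lemma wp_stratification P i f Q g sigma : wp ar P i f Q g ->
  {in instr_symbs i, forall s, known P s} -> stratification sigma P ->
  exists2 sigma', stratification sigma' Q &
    forall s, known P s -> sigma' s = sigma s.
Proof.
move=> w; elim: w sigma => {P i f Q g}.
- move=> P r x Phi f p pr sigma kPhi st.
  (* [m] is strictly above the strata of all literals of [Phi], some of which may be negated. *)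
  pose m := (\max_(l <- Phi) sigma (lit_symb l)).+1.
  have [sigma' [st' old prm _]] := prime_stratification m pr st.
  exists sigma' => // rho l; rewrite mem_cat => /orP[|]; first exact: st'.
  have dr := depends_refl P (Edb r).
  rewrite !inE => /orP[] /eqP-> /=; rewrite /head_symb /lit_symb /= (prm _ dr).
    by rewrite inE => /eqP-> /=; rewrite old // leq_addl.
  move=> lPhi; rewrite old; last exact/kPhi/map_f.
  have lt_m : sigma l.2.1 < m.
    by rewrite ltnS; apply: (leq_bigmax_seq (F := fun l => sigma (lit_symb l)) l).
  have : sigma l.2.1 < m.+1 + sigma (Edb r) by rewrite addSn ltnS ltnW // ltn_addr.
  by case: l.1 => // /ltnW.
- move=> P r x Phi f p t pr nt _ pt sigma kPhi st.
  (* Here [t] gets stratum [m]: strictly above [Phi], and strictly below [p (Edb r)], whose rule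
     negates [t]. *)
  pose m := (\max_(l <- Phi) sigma (lit_symb l)).+1.
  have [sigma' [st' old prm tm]] := prime_stratification m pr st.
  exists sigma' => // rho l; rewrite mem_cat => /orP[|]; first exact: st'.
  have dr := depends_refl P (Edb r).
  rewrite !inE => /orP[] /eqP-> /=; rewrite /head_symb /lit_symb /=.
    rewrite !inE (prm _ dr) => /orP[] /eqP-> /=; first by rewrite old // leq_addl.
    by rewrite tm // addSn ltnS leq_addr.
  move=> lPhi; rewrite old ?tm //; last exact/kPhi/map_f.
  have lt_m : sigma l.2.1 < m.
    by rewrite ltnS; apply: (leq_bigmax_seq (F := fun l => sigma (lit_symb l)) l).
  by case: l.1 => //; apply: ltnW.
- move=> P i1 i2 f Q2 g2 Q1 g1 w2 IH2 w1 IH1 sigma ki st.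
  have sub := (wp_extends w2).1.
  have [s|sigma2 st2 e2] := IH2 sigma _ st.
    by move=> si; apply: ki; rewrite mem_cat si orbT.
  have [s si|sigma1 st1 e1] := IH1 sigma2 _ st2.
    by apply: known_sub sub _; apply: ki; rewrite mem_cat si.
  by exists sigma1 => // s ks; rewrite e1 ?e2 //; apply: known_sub ks.
- move=> P c i1 i2 f Q1 g1 Q2 g2 w1 IH1 w2 IH2 dis sigma ki st.
  have [s si|sigma1 st1 e1] := IH1 sigma _ st.
    by apply: ki; rewrite !mem_cat si orbT.
  have [s si|sigma2 st2 e2] := IH2 sigma _ st.
    by apply: ki; rewrite !mem_cat si !orbT.
  (* The two stratifications can be glued: a symbol known to both [Q1] and [Q2] is known to [P],
     where both equal [sigma]. *)
  exists (fun s => if known Q1 s then sigma1 s else sigma2 s); last first.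
    by move=> s ks; rewrite (known_sub (wp_extends w1).1 ks) e1.
  have on2 s : known Q2 s -> (if known Q1 s then sigma1 s else sigma2 s) = sigma2 s.
    case: ifP => // k1 k2; suff kP : known P s by rewrite e1 ?e2.
    move: k1 k2; rewrite /known /new_idb !negb_and !negbK.
    by case: (is_idb s) => //=; apply: dis.
  move=> rho l; rewrite mem_cat => /orP[] rQ lr.
    rewrite (known_head rQ) (known_body rQ (map_f _ lr)); exact: st1.
  rewrite (on2 _ (known_head rQ)) (on2 _ (known_body rQ (map_f _ lr))); exact: st2.
Qed.

Lemma wp_stratified P i f Q g : wp ar P i f Q g ->
  {in instr_symbs i, forall s, known P s} -> stratified P -> stratified Q.
Proof.
by move=> w ki [sigma st]; have [sigma' st' _] := wp_stratification w ki st; exists sigma'.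
Qed.

(** Stated for stratified programs and arbitrary closed formulas, since in a sequence the first
    instruction meets [Q2] and [g2], which need be neither Horn nor a clause. *)
Lemma wp_correct P i f Q g : wp ar P i f Q g ->
  wf_program ar P -> stratified P -> wf_instr ar i ->
  wf_fml ar f -> closed f -> {in fml_symbs f, forall s, known P s} ->
  {in instr_symbs i, forall s, known P s} ->
  [/\ wf_program ar Q, wf_fml ar g, closed g,
      {in fml_symbs g, forall s, known Q s} &
      forall B, respects_arity B -> (models P (exec P i B) f <-> models Q B g)].
Proof.
move=> w; have := @wp_stratified _ _ _ _ _ w; elim: w => {P i f Q g}.
- move=> P r x Phi f p pr stQ wfP stP /= /and3P[/eqP sx ux wfPhi] wff cf kf ki.
  rewrite -/(insert_rules r p x Phi) in stQ *; set Q := _ ++ _ in stQ *.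
  have {}stQ := stQ ki stP.
  have new := @insert_rules_new P r p x Phi pr.
  have PQ : extends P Q by apply: (extends_prime pr) => rho /new[].
  have wfQ : wf_program ar Q.
    rewrite /wf_program all_cat; apply/andP; split; first exact: wf_prime_program.
    have /andP[idb _] := prime_edb_new pr.
    have := (pr.1 _ (depends_refl P (Edb r))).2.
    by rewrite /= /wf_rule /= wfPhi /wf_lits /= /wf_atom /= !size_map idb => ->; rewrite sx eqxx.
  split; rewrite ?wf_prime_fml //.
  + by rewrite /closed free_vars_prime.
  + rewrite fml_symbs_prime => _ /mapP[s /kf ks ->].
    apply: (known_prime pr _ _ ks); first by move=> rho h; rewrite mem_cat h.
    by apply: (@known_head _ _ Q (vatom D (p (Edb r)) x, Phi));
      rewrite !(mem_cat, inE) eqxx !orbT.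
  + move=> B arB; have e v : sat (model P (exec P (Insert r x Phi) B)) v f <->
        sat (model Q B) v (prime_fml P r p f).
      rewrite sat_prime; apply: sat_ext => s a /kf ks.
      apply: iff_sym; apply: (prime_model _ pr wfP stQ new _ _ ks) => [r' /negbTE ne|b] /=.
        by rewrite ne.
      (* [exec] evaluates the qualification in [P] and the new rules evaluate it in [Q]; the answers
         agree because [Q] extends [P]. *)
      by rewrite eqxx -(answers_extends _ _ stQ PQ) // insert_model.
    by split=> h v; apply/e.
- move=> P r x Phi f p t pr nt art pt stQ wfP stP /= /and3P[/eqP sx ux wfPhi] wff cf kf ki.
  rewrite -/(delete_rules r p t x Phi) in stQ *; set Q := _ ++ _ in stQ *.
  have {}stQ := stQ ki stP.
  have new := @delete_rules_new P r p t x Phi pr nt pt.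
  have PQ : extends P Q by apply: (extends_prime pr) => rho /new[].
  have wfQ : wf_program ar Q.
    rewrite /wf_program all_cat; apply/andP; split; first exact: wf_prime_program.
    have /andP[idb _] := prime_edb_new pr; have /andP[idbt _] := nt.
    have := (pr.1 _ (depends_refl P (Edb r))).2.
    rewrite /= /wf_rule /= wfPhi /wf_lits /= /wf_atom /= !size_map idb idbt art => ->.
    by rewrite sx eqxx.
  split; rewrite ?wf_prime_fml //.
  + by rewrite /closed free_vars_prime.
  + rewrite fml_symbs_prime => _ /mapP[s /kf ks ->].
    apply: (known_prime pr _ _ ks); first by move=> rho h; rewrite mem_cat h.
    by apply: (@known_head _ _ Q (vatom D (p (Edb r)) x,
      [:: (true, vatom D (Edb r) x); (false, vatom D t x)]));
      rewrite !(mem_cat, inE) eqxx !orbT.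
  + move=> B arB; have e v : sat (model P (exec P (Delete r x Phi) B)) v f <->
        sat (model Q B) v (prime_fml P r p f).
      rewrite sat_prime; apply: sat_ext => s a /kf ks.
      apply: iff_sym; apply: (prime_model _ pr wfP stQ new _ _ ks) => [r' /negbTE ne|b] /=.
        by rewrite ne.
      by rewrite eqxx -(answers_extends _ _ stQ PQ) // delete_model.
    by split=> h v; apply/e.
- move=> P i1 i2 f Q2 g2 Q1 g1 w2 IH2 w1 IH1 _ wfP stP /= /andP[wf1 wf2] wff cf kf ki.
  have PQ := wp_extends w2.
  have ki2 : {in instr_symbs i2, forall s, known P s}.
    by move=> s si; apply: ki; rewrite mem_cat si orbT.
  have ki1P : {in instr_symbs i1, forall s, known P s}.
    by move=> s si; apply: ki; rewrite mem_cat si.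
  have ki1 : {in instr_symbs i1, forall s, known Q2 s}.
    by move=> s /ki1P; apply: known_sub PQ.1.
  have stQ2 := wp_stratified w2 ki2 stP.
  have [wfQ2 wfg2 cg2 kg2 e2] :=
    IH2 (@wp_stratified _ _ _ _ _ w2) wfP stP wf2 wff cf kf ki2.
  have [wfQ1 wfg1 cg1 kg1 e1] :=
    IH1 (@wp_stratified _ _ _ _ _ w1) wfQ2 stQ2 wf1 wfg2 cg2 kg2 ki1.
  (* The induction hypothesis runs [i1] with [Q2] and the update runs it with [P]; both runs agree
     because [Q2] extends [P]. *)
  split=> // B arB; rewrite -e1 // (exec_extends _ stQ2 PQ) // e2 //.
  exact: exec_respects_arity.
- move=> P c i1 i2 f Q1 g1 Q2 g2 w1 IH1 w2 IH2 dis stQ wfP stP /=.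
  move=> /and3P[wfc wf1 wf2] wff cf kf ki.
  have {}stQ := stQ ki stP.
  have ki1 : {in instr_symbs i1, forall s, known P s}.
    by move=> s si; apply: ki; rewrite !mem_cat si orbT.
  have ki2 : {in instr_symbs i2, forall s, known P s}.
    by move=> s si; apply: ki; rewrite !mem_cat si !orbT.
  have kc : {in fml_symbs (clause_fml c), forall s, known P s}.
    by move=> s; rewrite fml_symbs_clause => sc; apply: ki; rewrite mem_cat sc.
  have [wfQ1 wfg1 cg1 kg1 e1] :=
    IH1 (@wp_stratified _ _ _ _ _ w1) wfP stP wf1 wff cf kf ki1.
  have [wfQ2 wfg2 cg2 kg2 e2] :=
    IH2 (@wp_stratified _ _ _ _ _ w2) wfP stP wf2 wff cf kf ki2.
  have PQ1 := wp_extends w1; have PQ2 := wp_extends w2.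
  have x1 : extends Q1 (Q1 ++ Q2) by apply: extends_cat PQ1 PQ2 dis.
  have x2 : extends Q2 (Q1 ++ Q2).
    apply: (@extends_perm _ (Q2 ++ Q1)); first by move=> rho; rewrite !mem_cat orbC.
    by apply: extends_cat PQ2 PQ1 _ => s s2 s1; apply: dis.
  have PQ := extends_trans PQ1 x1.
  have cc := clause_closed c.
  split.
  + by rewrite /wf_program all_cat; apply/andP.
  + by rewrite /= wf_clause_fml wfc wfg1 wfg2.
  + by rewrite /closed /= cc cg1 cg2.
  + move=> s /=; rewrite !mem_cat => /orP[]/orP[] h.
    * exact/(known_sub PQ.1)/kc.
    * exact/(known_sub x1.1)/kg1.
    * exact/(known_sub PQ.1)/kc.
    * exact/(known_sub x2.1)/kg2.
  + move=> B arB /=; have ec := models_extends B stQ PQ kc.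
    (* The condition has the same value in [Q1 ++ Q2] as in [P], so it eliminates the disjunct of
       the other branch; the remaining formula keeps its value from [Q1] or [Q2]. *)
    case: asboolP => hc.
      rewrite e1 // -(models_extends B stQ x1 kg1); split=> h v /=.
        by left; split; [apply/(closed_models _ _ _ cc)/ec|].
      by case: (h v) => /= [[]//|[[]]]; apply/(closed_models _ _ _ cc)/ec.
    rewrite e2 // -(models_extends B stQ x2 kg2); split=> h v /=.
      by right; split=> // /(closed_models _ _ _ cc)/ec.
    by case: (h v) => /= [[/(closed_models _ _ _ cc)/ec]|[]].
Qed.

End Correctness.

(** * Existence of fresh symbols *)

Section Existence.
Variables (D : pointedType) (k : nat) (ar : 'I_k -> nat).
Implicit Types (P Q : program D k) (f g : formula D k) (i : instr D k).
Implicit Types (s q : symb k).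

Definition idb_name s := if s is Idb n _ then n else 0.
Definition max_name P := \max_(s <- program_idbs P) idb_name s.

Lemma leq_max_name P s : s \in program_idbs P -> idb_name s <= max_name P.
Proof. by move=> sP; apply: (leq_bigmax_seq s). Qed.

Lemma new_idb_large P n a : max_name P < n -> new_idb P (Idb n a).
Proof.
by move=> lt_n; apply/negP => /leq_max_name /=; rewrite leqNgt lt_n.
Qed.

(** [pickle] numbers the countably many symbols injectively, so the names are distinct and all at
    least [n]. *)
Definition fresh_prime n s : symb k := Idb (n + pickle s) (arity ar s).

Lemma fresh_priming P r n : max_name P < n -> priming ar P r (fresh_prime n).
Proof.
move=> lt_n; split=> [q _|q s _ _ [/addnI/(pcan_inj pickleK)//]].
by split=> //; apply: new_idb_large; apply: ltn_addr.
Qed.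

Lemma fresh_idbs P r n m (extra : program D k) :
  n <= m ->
  (forall rho s, rho \in extra -> s \in rule_symbs rho ->
     known P s \/ n <= idb_name s) ->
  forall s, s \in program_idbs (prime_program P r (fresh_prime m) ++ extra) ->
    s \notin program_idbs P -> n <= idb_name s.
Proof.
move=> le_m ex s /mem_program_idbs[idb [rho rQ sr]] nP.
have ks : known P s -> n <= idb_name s.
  by rewrite /known /new_idb idb nP.
have kp q : known P q -> s = prime_symb P r (fresh_prime m) q -> n <= idb_name s.
  rewrite /prime_symb; case: asboolP => _ kq e; last by apply: ks; rewrite e.
  by rewrite e /=; apply: leq_trans (leq_addr _ _).
move: rQ; rewrite mem_cat => /orP[/mem_prime_program[rP|]|/ex h]; last first.
- by case: (h _ sr).
- case=> rho0 [rP _ re]; move: sr; rewrite re inE => /orP[/eqP|].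
    by apply: kp; apply: known_head.
  rewrite -map_comp => /mapP[l lr]; apply: kp; exact/(known_body rP)/map_f.
- by apply: ks; apply: known_rule sr.
Qed.

(** The lower bound [n] on the new names strengthens the induction: one branch of a conditional can
    avoid the symbols introduced by the other. *)
Lemma wp_exists P i f n : {in instr_symbs i, forall s, known P s} ->
  exists Q g, wp ar P i f Q g /\
    forall s, s \in program_idbs Q -> s \notin program_idbs P -> n <= idb_name s.
Proof.
elim: i P f n => [r x Phi|r x Phi|i1 IH1 i2 IH2|c i1 IH1 i2 IH2] P f n /= ki.
- pose m := n + (max_name P).+1.
  have pr : priming ar P r (fresh_prime m) by apply: fresh_priming; rewrite leq_addl.
  do 2 eexists; split; first exact: wp_insert pr.
  apply: fresh_idbs => [|rho s]; first exact: leq_addr.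
  rewrite !inE => /orP[] /eqP-> /=; rewrite ?inE => /orP[/eqP->|].
  + by right; rewrite /= -addnA leq_addr.
  + by move/eqP->; left.
  + by right; rewrite /= -addnA leq_addr.
  + by move/ki; left.
- pose m := n + (max_name P).+1.
  have ltm : max_name P < m by rewrite leq_addl.
  (* The name [m] is reserved for [t], so primed names start at [m.+1]. *)
  have pr : priming ar P r (fresh_prime m.+1) by apply: fresh_priming; apply: leqW.
  have nt : new_idb P (Idb m (ar r)) by apply: new_idb_large.
  do 2 eexists; split.
    apply: (wp_delete x Phi f pr nt) => // q _ [].
    by rewrite addSn => /eqP; rewrite gtn_eqF // ltnS leq_addr.
  apply: fresh_idbs => [|rho s]; first by rewrite leqW // leq_addr.
  have le_m : n <= m by rewrite leq_addr.
  have le_p : n <= m.+1 + pickle (Edb r) by rewrite (leq_trans le_m) // addSn leqW // leq_addr.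
  rewrite !inE => /orP[] /eqP-> /=; rewrite ?inE.
  + by case/or3P => /eqP->; [right|left|right].
  + by case/orP => [/eqP->|/ki]; [right|left].
- have [s si|Q2 [g2 [w2 h2]]] := IH2 P f n.
    by apply: ki; rewrite mem_cat si orbT.
  have sub := (wp_extends w2).1.
  have [s si|Q1 [g1 [w1 h1]]] := IH1 Q2 g2 n.
    by apply: known_sub sub _; apply: ki; rewrite mem_cat si.
  exists Q1, g1; split; first exact: wp_seq w2 w1.
  move=> s s1 nP; case: (boolP (s \in program_idbs Q2)) => [s2|]; first exact: h2.
  exact: h1.
- have [s si|Q1 [g1 [w1 h1]]] := IH1 P f n.
    by apply: ki; rewrite !mem_cat si orbT.
  (* The names new in [Q2] exceed all names of [Q1], which gives the disjointness required by
     [wp_if]. *)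
  have [s si|Q2 [g2 [w2 h2]]] := IH2 P f (n + (max_name Q1).+1).
    by apply: ki; rewrite !mem_cat si !orbT.
  do 2 eexists; split.
    apply: wp_if w1 w2 _ => s s1 s2; apply: contraT => nP.
    have := leq_max_name s1; rewrite leqNgt.
    by rewrite (leq_trans (leq_addl n _) (h2 _ s2 nP)).
  move=> s /mem_program_idbs[idb [rho]]; rewrite mem_cat => /orP[] rQ sr nP.
    by apply: h1 => //; apply/mem_program_idbs; split=> //; exists rho.
  apply: leq_trans (leq_addr _ _) (h2 s _ nP).
  by apply/mem_program_idbs; split=> //; exists rho.
Qed.

End Existence.

Theorem theorem3 (k : nat) (ar : 'I_k -> nat) (D : pointedType)
    (P : program D k) (i : instr D k) (c : clause D k) :
  datalog ar P -> wf_instr ar i -> wf_lits ar c ->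
  hypothesis1 P i c -> hypothesis2 P i ->
  (exists (Q : program D k) (f : formula D k), wp ar P i (clause_fml c) Q f) /\
  (forall (Q : program D k) (f : formula D k),
     wp ar P i (clause_fml c) Q f ->
     weakest_precondition ar P i (clause_fml c) Q f).
Proof.
move=> /andP[wfP hornP] wfi wfc h1 _.
(* Without negated atoms a single stratum suffices. *)
have stP : stratified P.
  by exists (fun=> 0) => rho l rP lr; rewrite (allP (allP hornP _ rP) _ lr).
(* The IDBs of [c] and [i] head rules of [P], so symbols new for [P] occur neither in [c] nor in
   [i]. *)
have ksymb s : s \in map (@lit_symb D k) c ++ instr_symbs i -> known P s.
  move=> ss; case: (boolP (is_idb s)) => [idb|/negbTE ni]; last first.
    by rewrite /known /new_idb ni.
  by have /mapP[rho rP ->] := h1 s idb ss; apply: known_head.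
have ki : {in instr_symbs i, forall s, known P s}.
  by move=> s si; apply: ksymb; rewrite mem_cat si orbT.
have kc : {in fml_symbs (clause_fml c), forall s, known P s}.
  by move=> s; rewrite fml_symbs_clause => sc; apply: ksymb; rewrite mem_cat sc.
split; first by have [Q [f [w _]]] := wp_exists ar (clause_fml c) 0 ki; exists Q, f.
move=> Q f w; have stQ := wp_stratified w ki stP.
have [||wfQ wff cf _ e] := wp_correct w wfP stP wfi _ _ kc ki.
- by rewrite wf_clause_fml.
- exact: clause_closed.
have arB (B : 'I_k -> set (seq D)) : database ar B -> respects_arity ar B.
  by move=> dB r a /((dB r).2 a).
split; first by split=> // B /arB/e[].
(* If a precondition holds in [B], the updated database satisfies [c], which is equivalent to [f]
   holding in [B]. *)
by move=> Q' g [_ pre] B dB /(pre B dB)/(e B (arB B dB)).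
Qed.
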